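(* In the lattice vertex operator algebra $V_Q$ of the $E_6$ root lattice (setting below), let $\omega_{E_6}=\frac12\sum_{i=1}^6\alpha_i(-1)\lambda_i(-1)(1\otimes e^0)$ and let $\omega_{F_4}=\frac1{20}\sum_iu_i(-1)u^i(-1)(1\otimes e^0)$ be the Sugawara vector of the $F_4$ subalgebra $\mathfrak a$. Then the coset vector $\omega=\omega_{E_6}-\omega_{F_4}$ is $$\begin{aligned}\omega=&\tfrac1{10}\big[(-\lambda_1+\lambda_6)(-1)^2+(\lambda_3-\lambda_5)(-1)^2+(\lambda_1-\lambda_3+\lambda_5-\lambda_6)(-1)^2\big]\otimes e^0\\&+\tfrac15\big(-1\otimes e^{\alpha_1-\alpha_6}-1\otimes e^{\alpha_3-\alpha_5}+1\otimes e^{\alpha_1+\alpha_3-\alpha_5-\alpha_6}\big)\\&+\tfrac15\big(-1\otimes e^{-\alpha_1+\alpha_6}-1\otimes e^{-\alpha_3+\alpha_5}+1\otimes e^{-\alpha_1-\alpha_3+\alpha_5+\alpha_6}\big).\end{aligned}$$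
   Context: Setting. $Q$ is the root lattice of $E_6$ with simple roots $\alpha_1,\dots,\alpha_6$ labelled so that the Dynkin diagram is the chain $\alpha_1-\alpha_3-\alpha_4-\alpha_5-\alpha_6$ with $\alpha_2$ attached to $\alpha_4$; $\langle\cdot,\cdot\rangle$ is given by the Cartan matrix. $\lambda_i$ are the fundamental weights ($\langle\lambda_i,\alpha_j\rangle=\delta_{ij}$), $P=\bigoplus\mathbb Z\lambda_i$, $\mathfrak h=\mathbb C\otimes P$, $\Phi=\{\alpha\in Q:\langle\alpha,\alpha\rangle=2\}$. $\varepsilon:P\times P\to\{\pm1\}$ is bimultiplicative with $[\varepsilon(\lambda_i,\lambda_j)]$ having rows $(1,1,1,1,1,1)$, $(-1,1,1,1,1,-1)$, $(-1,1,1,1,1,1)$, $(1,-1,1,1,1,1)$, $(1,1,1,1,1,-1)$, $(1,1,1,1,1,1)$. $V_Q=S(\hat{\mathfrak h}^-)\otimes\mathbb C[Q]$ with Heisenberg operators $h(n)$ ($[h(m),h'(n)]=m\langle h,h'\rangle\delta_{m+n,0}$, $h(n)1=0$ for $n>0$, $h(0)(u\otimes e^\beta)=\langle h,\beta\rangle u\otimes e^\beta$) and $Y(1\otimes e^\alpha,z)=\exp(\sum_{k\ge1}\frac{\alpha(-k)}kz^k)\exp(-\sum_{k\ge1}\frac{\alpha(k)}kz^{-k})e_\alpha z^{\alpha(0)}=\sum_n\{1\otimes e^\alpha\}_nz^{-n-1}$, $e_\alpha(u\otimes e^\beta)=\varepsilon(\alpha,\beta)u\otimes e^{\alpha+\beta}$,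 $z^{\alpha(0)}(u\otimes e^\beta)=z^{\langle\alpha,\beta\rangle}u\otimes e^\beta$. $\mathfrak g=\mathfrak h\oplus\bigoplus_{\alpha\in\Phi}\mathbb Cx_\alpha$ (type $E_6$) has invariant form $\langle x_\alpha,x_\beta\rangle=\varepsilon(\alpha,-\alpha)\delta_{\alpha+\beta,0}$, $\langle\mathfrak h,x_\alpha\rangle=0$; $x(n)$ for $x\in\mathfrak g$ acts by $h(n)$ for $h\in\mathfrak h$ and $x_\alpha(n)=\{1\otimes e^\alpha\}_n$. $\tau$ is the diagram automorphism $\alpha_1\leftrightarrow\alpha_6$, $\alpha_3\leftrightarrow\alpha_5$, acting on $\mathfrak g$ linearly on $\mathfrak h$ and by $x_\alpha\mapsto x_{\tau\alpha}$; $\mathfrak a$ (type $F_4$) is the $\tau$-fixed subalgebra, with basis $\alpha_2,\alpha_4,\alpha_3+\alpha_5,\alpha_1+\alpha_6\in\mathfrak h$, $x_\alpha$ ($\tau\alpha=\alpha$), $x_\alpha+x_{\tau\alpha}$ ($\tau\alpha\ne\alpha$). $\{u_i\}$ is a basis of $\mathfrak a$, $\{u^i\}$ its dual basis with respect to $\langle\cdot,\cdot\rangle|_{\mathfrak a}$. *)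

(* Defs.v *)
From HB Require Import structures.
From mathcomp Require Import all_boot all_order all_algebra.
Set Implicit Arguments. Unset Strict Implicit. Unset Printing Implicit Defensive.
Import Order.TTheory GRing.Theory Num.Theory.
Local Open Scope ring_scope.

(* Simple roots alpha_1..alpha_6 are indexed by 'I_6 as 0..5.
   Dynkin diagram: a1-a3-a4-a5-a6 and a2-a4. *)
Definition dynkin_edges : seq (nat * nat) :=
  [:: (0, 2); (2, 3); (3, 4); (4, 5); (1, 3)]%N.
Definition adj (i j : 'I_6) : bool :=
  ((nat_of_ord i, nat_of_ord j) \in dynkin_edges) ||
  ((nat_of_ord j, nat_of_ord i) \in dynkin_edges).
Definition cartan : 'M[int]_6 :=
  \matrix_(i, j) (if i == j then 2 else if adj i j then -1 else 0).

(* The root lattice Q, elements written in coordinates w.r.t. alpha_i. *)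
Notation Q := 'rV[int]_6.
Definition formQ (a b : Q) : int :=
  \sum_(i < 6) \sum_(j < 6) a 0 i * cartan i j * b 0 j.
Definition aQ (i : 'I_6) : Q := delta_mx 0 i.

Definition tau (i : 'I_6) : 'I_6 := inord (nth 0%N [:: 5; 1; 4; 3; 2; 0]%N i).
Definition tauQ (a : Q) : Q := \row_i a 0 (tau i).

(* Coordinates of a in Q w.r.t. the fundamental weights:
   alpha_i = sum_j cartan i j lambda_j. *)
Definition lamcoord (a : Q) : 'rV[int]_6 := a *m cartan.

(* The matrix [eps(lambda_i, lambda_j)]. *)
Definition eps_rows : seq (seq int) :=
  [:: [:: 1; 1; 1; 1; 1; 1];
      [:: -1; 1; 1; 1; 1; -1];
      [:: -1; 1; 1; 1; 1; 1];
      [:: 1; -1; 1; 1; 1; 1];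
      [:: 1; 1; 1; 1; 1; -1];
      [:: 1; 1; 1; 1; 1; 1]].
Definition epsM : 'M[int]_6 := \matrix_(i, j) nth 1 (nth [::] eps_rows i) j.

Section VQ.
Variable C : numClosedFieldType.

Definition eps (a b : Q) : C :=
  \prod_(j < 6) \prod_(k < 6)
     ((epsM j k)%:~R : C) ^ (lamcoord a 0 j * lamcoord b 0 k).

(* h = C (x) P, elements written in coordinates w.r.t. alpha_i *)
Definition H := 'rV[C]_6.
Definition cartanC : 'M[C]_6 := map_mx (fun z : int => z%:~R) cartan.
Definition formH (h h' : H) : C := (h *m cartanC *m h'^T) 0 0.
Definition embQ (a : Q) : H := map_mx (fun z : int => z%:~R) a.
Definition alphaH (i : 'I_6) : H := delta_mx 0 i.
(* fundamental weights: <lambda_i, alpha_j> = delta_ij *)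
Definition lamH (i : 'I_6) : H := row i (invmx cartanC).

(* S(h^-) (x) C[Q].  A monomial is a list of pairs (j, k), k >= 1,
   standing for the product of the alpha_j(-k); a vector is a finite formal
   linear combination of basis vectors (monomial (x) e^beta);
   two vectors are equal when all their coefficients agree. *)
Definition mono := seq ('I_6 * nat).
Definition term := (C * (mono * Q))%type.
Definition V := seq term.

Definition coefV (v : V) (m : mono) (b : Q) : C :=
  \sum_(t <- v | perm_eq t.2.1 m && (t.2.2 == b)) t.1.
Definition veq (u v : V) : Prop := forall m b, coefV u m b = coefV v m b.

Definition scaleV (c : C) (v : V) : V := [seq (c * t.1, t.2) | t <- v].
Definition liftV (f : C -> mono -> Q -> V) (v : V) : V :=
  flatten [seq f t.1 t.2.1 t.2.2 | t <- v].

(* Heisenberg operators h(n). h(-k) multiplies by h(-k) = sum_j h_j alpha_j(-k);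
   h(k), k > 0, acts as the derivation sum_j k <h,alpha_j> d/d(alpha_j(-k));
   h(0) acts by <h, beta>. *)
Definition heis (h : H) (n : int) : V -> V :=
  liftV (fun c m b =>
    match n with
    | Posz 0 => [:: (c * formH h (embQ b), (m, b))]
    | Posz k.+1 =>
        [seq (c * (k.+1)%:R * (h *m cartanC) 0 j * (count_mem (j, k.+1) m)%:R,
              (rem (j, k.+1) m, b)) | j <- enum 'I_6]
    | Negz k => [seq (c * h 0 j, ((j, k.+1) :: m, b)) | j <- enum 'I_6]
    end).

(* Coefficient of z^p in A(z)^j where A(z) = sum_{k>=1} f k z^k
   (the f k are commuting operators). *)
Fixpoint powcoef (f : nat -> V -> V) (j p : nat) (v : V) : V :=
  match j with
  | 0 => if p == 0%N then v else [::]
  | j'.+1 => flatten [seq f k (powcoef f j' (p - k) v) | k <- iota 1 p]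
  end.
(* Coefficient of z^p in exp(A(z)) = sum_j A(z)^j / j!
   (only j <= p contribute). *)
Definition expcoef (f : nat -> V -> V) (p : nat) (v : V) : V :=
  flatten [seq scaleV (j`!%:R)^-1 (powcoef f j p v) | j <- iota 0 p.+1].

Definition weight (m : mono) : nat := sumn (map snd m).

(* {1 (x) e^a}_n : coefficient of z^{-n-1} in
   Y(e^a,z) = exp(sum a(-k) z^k/k) exp(-sum a(k) z^{-k}/k) e_a z^{a(0)}.
   On u (x) e^b, the E^+ factor contributes only z^{-q} with q <= weight u. *)
Definition Ymode (a : Q) (n : int) : V -> V :=
  liftV (fun c m b =>
    let s := formQ a b in
    let v0 : V := [:: (c * eps a b, (m, a + b))] in
    flatten [seq (let p : int := q%:Z - s - n - 1 in
                  if 0 <= p then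
                    expcoef (fun k => scaleV (k%:R^-1) \o heis (embQ a) (- k%:Z))
                      (absz p)
                      (expcoef (fun k => scaleV (- (k%:R^-1)) \o heis (embQ a) k%:Z)
                         q v0)
                  else [::])
            | q <- iota 0 (weight m).+1]).

(* The Lie algebra g = h + sum_alpha C x_alpha: an element is a pair
   (h-part, finite formal combination of the x_alpha). *)
Definition gel := (H * seq (C * Q))%type.
Definition coefR (r : seq (C * Q)) (a : Q) : C := \sum_(t <- r | t.2 == a) t.1.
Definition g_eq (x y : gel) : Prop := x.1 = y.1 /\ forall a, coefR x.2 a = coefR y.2 a.
Definition g0 : gel := (0, [::]).
Definition gadd (x y : gel) : gel := (x.1 + y.1, x.2 ++ y.2).
Definition gscale (c : C) (x : gel) : gel := (c *: x.1, [seq (c * t.1, t.2) | t <- x.2]).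
Definition lincomb (n : nat) (c : 'I_n -> C) (u : 'I_n -> gel) : gel :=
  foldr gadd g0 [seq gscale (c i) (u i) | i <- enum 'I_n].

(* x lies in g (root part supported on Phi) and is tau-fixed: x in a = F4 *)
Definition inA (x : gel) : Prop :=
  [/\ (forall a, coefR x.2 a != 0 -> formQ a a = 2),
      (forall i, x.1 0 (tau i) = x.1 0 i) &
      (forall a, coefR x.2 (tauQ a) = coefR x.2 a)].

Definition gform (x y : gel) : C :=
  formH x.1 y.1 +
  \sum_(s <- x.2) \sum_(t <- y.2)
     (s.1 * t.1 * (if s.2 + t.2 == 0 then eps s.2 (- s.2) else 0)).

Definition gact (x : gel) (n : int) (v : V) : V :=
  heis x.1 n v ++ flatten [seq scaleV t.1 (Ymode t.2 n v) | t <- x.2].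

Definition vac : V := [:: (1, ([::], 0))].

Definition omegaE6 : V :=
  scaleV (1 / 2%:R)
    (flatten [seq heis (alphaH i) (-1) (heis (lamH i) (-1) vac) | i <- enum 'I_6]).

Definition omegaF4 (n : nat) (u u' : 'I_n -> gel) : V :=
  scaleV (1 / 20%:R)
    (flatten [seq gact (u i) (-1) (gact (u' i) (-1) vac) | i <- enum 'I_n]).

Definition omega (n : nat) (u u' : 'I_n -> gel) : V :=
  omegaE6 ++ scaleV (-1) (omegaF4 u u').

Definition sqv (h : H) : V := heis h (-1) (heis h (-1) vac).
Definition ev (c : C) (b : Q) : V := [:: (c, ([::], b))].

Definition omega_rhs : V :=
  scaleV (1 / 10%:R)
    (sqv (- lamH 0 + lamH 5) ++ sqv (lamH 2 - lamH 4)
       ++ sqv (lamH 0 - lamH 2 + lamH 4 - lamH 5))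
  ++ scaleV (1 / 5%:R)
    (ev (-1) (aQ 0 - aQ 5) ++ ev (-1) (aQ 2 - aQ 4)
       ++ ev 1 (aQ 0 + aQ 2 - aQ 4 - aQ 5))
  ++ scaleV (1 / 5%:R)
    (ev (-1) (- aQ 0 + aQ 5) ++ ev (-1) (- aQ 2 + aQ 4)
       ++ ev 1 (- aQ 0 - aQ 2 + aQ 4 + aQ 5)).

End VQ.

(* Main.v *)
Require Import Defs.
From HB Require Import structures.
From mathcomp Require Import all_boot all_order all_algebra.
From mathcomp Require Import zify ring.
Import Order.TTheory GRing.Theory Num.Theory.
Local Open Scope ring_scope.

Set Implicit Arguments.
Unset Strict Implicit.
Unset Printing Implicit Defensive.

(* Let B(x, y) = x(-1) y(-1) 1, a bilinear map on g.  If [d_k] is the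
   orthogonal projection to a of the dual basis of a basis [b_k] of g, then
   <d_k, y> is the k-th coordinate of y for every y in a; expanding u'_i in the
   [b_k] and resumming over i gives sum_i B(u_i, u'_i) = sum_k B(d_k, b_k).
   With [b_k] the alpha_j and the x_alpha, the [d_k] are (lambda_j + tau lambda_j)/2
   and eps(-alpha, alpha) (x_{-alpha} + x_{-tau alpha})/2.  The term of x_alpha
   only involves <-alpha, alpha> = -2 and, when tau alpha <> alpha,
   <-tau alpha, alpha> = 0, which produces the e^{alpha - tau alpha}; what remains
   is a finite computation over the 72 roots. *)

(** * Linearity of the coefficients of modes *)

Section FormalVectors.
Variable C : numClosedFieldType.
Implicit Types (u v : V C) (m : mono) (b : Q) (c : C).

Lemma coefV_nil m b : coefV ([::] : V C) m b = 0.
Proof. exact: big_nil. Qed.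

Lemma coefV_cat u v m b : coefV (u ++ v) m b = coefV u m b + coefV v m b.
Proof. exact: big_cat. Qed.

Lemma coefV_scale c v m b : coefV (scaleV c v) m b = c * coefV v m b.
Proof. by rewrite /coefV /scaleV big_map mulr_sumr. Qed.

Lemma coefV_flatten (T : Type) (s : seq T) (f : T -> V C) m b :
  coefV (flatten [seq f i | i <- s]) m b = \sum_(i <- s) coefV (f i) m b.
Proof.
elim: s => [|i s IHs]; first by rewrite big_nil coefV_nil.
by rewrite /= coefV_cat IHs big_cons.
Qed.

Lemma coefV_flatten_enum n (f : 'I_n -> V C) m b :
  coefV (flatten [seq f i | i <- enum 'I_n]) m b = \sum_i coefV (f i) m b.
Proof. by rewrite coefV_flatten big_enum. Qed.

Lemma coefV_cons c m0 b0 v m b :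
  coefV ((c, (m0, b0)) :: v) m b =
  c * coefV [:: (1, (m0, b0))] m b + coefV v m b.
Proof. by rewrite /coefV !big_cons !big_nil /=; case: ifP; rewrite ?addr0 ?mulr1 ?mulr0 ?add0r. Qed.

Lemma scaleV1 v : scaleV 1 v = v.
Proof. by rewrite /scaleV -[RHS]map_id; apply: eq_map => -[a ?]; rewrite mul1r. Qed.

Lemma scaleVA c d v : scaleV c (scaleV d v) = scaleV (c * d) v.
Proof. by rewrite /scaleV -map_comp; apply: eq_map => t /=; rewrite mulrA. Qed.

Lemma scaleVC c d v : scaleV c (scaleV d v) = scaleV d (scaleV c v).
Proof. by rewrite !scaleVA mulrC. Qed.

Lemma scaleV_flatten (T : Type) c (s : seq T) (f : T -> V C) :
  scaleV c (flatten [seq f i | i <- s]) = flatten [seq scaleV c (f i) | i <- s].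
Proof. by rewrite /scaleV map_flatten -map_comp. Qed.

Lemma liftV_cat (f : C -> mono -> Q -> V C) u v :
  liftV f (u ++ v) = liftV f u ++ liftV f v.
Proof. by rewrite /liftV map_cat flatten_cat. Qed.

Lemma liftV_scale (f : C -> mono -> Q -> V C) c v :
    (forall d m b, f (c * d) m b = scaleV c (f d m b)) ->
  liftV f (scaleV c v) = scaleV c (liftV f v).
Proof.
move=> fc; rewrite /liftV scaleV_flatten /scaleV -map_comp.
by congr flatten; apply: eq_map => t /=; rewrite fc.
Qed.

Lemma heis_scale (h : H C) n c v : heis h n (scaleV c v) = scaleV c (heis h n v).
Proof.
apply: liftV_scale => d m b.
case: n => [[|k]|k]; rewrite /scaleV; first by rewrite /= mulrA.
  rewrite -[RHS]map_comp; apply: eq_map => j /=; by rewrite !mulrA.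
by rewrite -[RHS]map_comp; apply: eq_map => j /=; rewrite !mulrA.
Qed.

Lemma powcoef_scale (f : nat -> V C -> V C) c :
    (forall k v, f k (scaleV c v) = scaleV c (f k v)) ->
  forall j p v, powcoef f j p (scaleV c v) = scaleV c (powcoef f j p v).
Proof.
move=> fc; elim=> [|j IHj] p v /=; first by case: ifP.
by rewrite scaleV_flatten; congr flatten; apply: eq_map => k; rewrite IHj fc.
Qed.

Lemma expcoef_scale (f : nat -> V C -> V C) c p v :
    (forall k v, f k (scaleV c v) = scaleV c (f k v)) ->
  expcoef f p (scaleV c v) = scaleV c (expcoef f p v).
Proof.
move=> fc; rewrite /expcoef scaleV_flatten; congr flatten; apply: eq_map => j.
by rewrite powcoef_scale // scaleVC.
Qed.

Lemma Ymode_scale a n c v : Ymode a n (scaleV c v) = scaleV c (Ymode a n v).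
Proof.
apply: liftV_scale => d m b; rewrite scaleV_flatten; congr flatten.
apply: eq_map => q /=.
have -> : [:: (c * d * eps C a b, (m, a + b))] =
          scaleV c [:: (d * eps C a b, (m, a + b))] by rewrite /scaleV /= mulrA.
case: ifP => // _; rewrite !expcoef_scale // => k w /=;
by rewrite heis_scale scaleVC.
Qed.

Lemma coef_gact (x : gel C) n v m b :
  coefV (gact x n v) m b =
  coefV (heis x.1 n v) m b + \sum_(t <- x.2) t.1 * coefV (Ymode t.2 n v) m b.
Proof.
rewrite /gact coefV_cat coefV_flatten; congr (_ + _).
by apply: eq_bigr => t _; rewrite coefV_scale.
Qed.

Lemma coef_gact_cat (x : gel C) n u v m b :
  coefV (gact x n (u ++ v)) m b = coefV (gact x n u) m b + coefV (gact x n v) m b.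
Proof.
rewrite !coef_gact /heis liftV_cat coefV_cat addrACA -big_split /=.
by congr (_ + _); apply: eq_bigr => t _; rewrite -mulrDr -coefV_cat -liftV_cat.
Qed.

Lemma coef_gact_scale (x : gel C) n c v m b :
  coefV (gact x n (scaleV c v)) m b = c * coefV (gact x n v) m b.
Proof.
rewrite !coef_gact heis_scale coefV_scale mulrDr mulr_sumr; congr (_ + _).
by apply: eq_bigr => t _; rewrite Ymode_scale coefV_scale mulrCA.
Qed.

Lemma coef_gact_expand (x : gel C) n v m b :
  coefV (gact x n v) m b =
  \sum_(t <- v) t.1 * coefV (gact x n [:: (1, t.2)]) m b.
Proof.
elim: v => [|[c mb] v IHv].
  (* The empty combination is 0 times itself, so homogeneity kills its image. *)
  rewrite big_nil -[[::]]/(scaleV 0 [::]).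
  by rewrite coef_gact_scale mul0r.
rewrite big_cons -IHv -cat1s coef_gact_cat -coef_gact_scale.
by rewrite /scaleV /= mulr1.
Qed.

Lemma coef_heisN (h : H C) k v m b :
  coefV (heis h (- k.+1%:Z) v) m b =
  \sum_(t <- v) \sum_j t.1 * h 0 j * coefV [:: (1, ((j, k.+1) :: t.2.1, t.2.2))] m b.
Proof.
rewrite -NegzE /heis /liftV coefV_flatten; apply: eq_bigr => t _.
rewrite /coefV big_map big_enum_cond /= big_mkcond; apply: eq_bigr => j _ /=.
by rewrite big_mkcond big_cons big_nil /=; case: ifP; rewrite ?addr0 ?mulr1 ?mulr0.
Qed.

Lemma coef_heisN_ev (h : H C) k c b0 m b :
  coefV (heis h (- k.+1%:Z) (ev c b0)) m b =
  c * \sum_j h 0 j * coefV [:: (1, ([:: (j, k.+1)], b0))] m b.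
Proof.
by rewrite coef_heisN big_seq1 mulr_sumr; apply: eq_bigr => j _; rewrite mulrA.
Qed.

Lemma coef_heis_heis (h h' : H C) c b0 m b :
  coefV (heis h (-1) (heis h' (-1) (ev c b0))) m b =
  c * \sum_i \sum_j h 0 i * h' 0 j * coefV [:: (1, ([:: (i, 1%N); (j, 1%N)], b0))] m b.
Proof.
rewrite (coef_heisN _ 0) /heis /liftV /= cats0 big_map big_enum /= mulr_sumr exchange_big.
apply: eq_bigr => i _; rewrite mulr_sumr; apply: eq_bigr => j _ /=.
by rewrite !mulrA [c * _ * _]mulrAC.
Qed.

End FormalVectors.

(** * Linear functionals on g and dual bases *)

Section Functionals.
Variable C : numClosedFieldType.
Implicit Types (v : V C) (m : mono) (b : Q) (x y : gel C).

Lemma coefR_mem (r : seq (C * Q)) a : coefR r a != 0 -> a \in map snd r.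
Proof.
apply: contraNT => /mapP nra; rewrite /coefR big_seq_cond big1 // => t.
by case/andP=> tr /eqP ta; case: nra; exists t.
Qed.

Lemma sum_fiber (I T : eqType) (r : seq I) (p : I -> T) (w : I -> C)
    (g : T -> C) (S : seq T) :
    uniq S -> {in r, forall t, p t \in S} ->
  \sum_(t <- r) w t * g (p t) = \sum_(k <- S) (\sum_(t <- r | p t == k) w t) * g k.
Proof.
move=> uS rS.
under [RHS]eq_bigr => k _ do rewrite big_mkcond mulr_suml.
rewrite exchange_big /=; apply: eq_big_seq => t /rS tS.
rewrite (bigD1_seq _ tS) //= eqxx big1 ?addr0 // => k.
by rewrite eq_sym => /negPf ->; rewrite mul0r.
Qed.

(** A formal combination may list a root several times, even with cancelling coefficients. Only the
    collected coefficients matter, so any duplicate-free list covering the support can index the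
    sum. *)
Lemma sum_coefR (r : seq (C * Q)) (S : seq Q) (g : Q -> C) :
    uniq S -> (forall a, coefR r a != 0 -> a \in S) ->
  \sum_(t <- r) t.1 * g t.2 = \sum_(k <- S) coefR r k * g k.
Proof.
move=> uS rS; set S' := undup (S ++ map snd r).
rewrite (@sum_fiber _ _ r snd fst g S') ?undup_uniq //; last first.
  by move=> t tr; rewrite mem_undup mem_cat map_f ?orbT.
rewrite -/(coefR _ _) (bigID (mem S)) /= [X in _ + X]big1 ?addr0 => [|k]; last first.
  by move=> kS; rewrite -/(coefR r k) (_ : coefR r k = 0) ?mul0r //; apply: contraNeq kS; apply: rS.
rewrite -big_filter; apply: perm_big; apply: uniq_perm => //.
  by rewrite filter_uniq ?undup_uniq.
by move=> k; rewrite mem_filter mem_undup mem_cat /=; case: (k \in S).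
Qed.

(* Common shape of [gform x y] and of the coefficients of [gact x (-1) v],
   as functions of [x]. *)
Definition gfun (L : H C -> C) (g : Q -> C) x : C :=
  L x.1 + \sum_(t <- x.2) t.1 * g t.2.

(** These functionals are well defined on g: both values become sums over one common list of all
    roots named in [x] or [y]. *)
Lemma gfun_eq L g x y : g_eq x y -> gfun L g x = gfun L g y.
Proof.
case=> xy1 xy2; rewrite /gfun xy1; congr (_ + _).
set S := undup (map snd x.2 ++ map snd y.2).
have uS : uniq S := undup_uniq _.
rewrite !(@sum_coefR _ S) // => [|a /coefR_mem|a /coefR_mem].
- by apply: eq_bigr => k _; rewrite xy2.
- by rewrite mem_undup mem_cat => ->; rewrite orbT.
- by rewrite mem_undup mem_cat => ->.
Qed.

Lemma gfun_lincomb L g n (c : 'I_n -> C) (u : 'I_n -> gel C) :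
  scalar L -> gfun L g (lincomb c u) = \sum_i c i * gfun L g (u i).
Proof.
move=> linL; rewrite /lincomb -big_enum.
have L0 : L 0 = 0.
  by have:= linL 1 0 0; rewrite scale1r addr0 mul1r => e; apply: (addrI (L 0)); rewrite addr0 -e.
elim: (enum 'I_n) => [|i s IHs].
  by rewrite big_nil /gfun /= L0 big_nil addr0.
rewrite big_cons -IHs /gfun /= linL big_cat big_map /= mulrDr addrACA mulr_sumr.
by congr (_ + _ + _); apply: eq_bigr => t _; rewrite mulrA.
Qed.

Lemma scalar_coef_heis v m b : scalar (fun h : H C => coefV (heis h (-1) v) m b).
Proof.
move=> a h h'; rewrite !(coef_heisN _ 0) mulr_sumr -big_split; apply: eq_bigr => t _.
rewrite mulr_sumr -big_split; apply: eq_bigr => j _ /=.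
by rewrite !mxE; ring.
Qed.

Lemma coef_gactE x v m b : coefV (gact x (-1) v) m b =
  gfun (fun h => coefV (heis h (-1) v) m b) (fun a => coefV (Ymode a (-1) v) m b) x.
Proof. exact: coef_gact. Qed.

Lemma gformE x y : gform x y =
  gfun (fun h => formH h y.1) (fun a => \sum_(t <- y.2)
     t.1 * (if a + t.2 == 0 then eps C a (- a) else 0)) x.
Proof.
rewrite /gform /gfun; congr (_ + _); apply: eq_bigr => s _.
by rewrite mulr_sumr; apply: eq_bigr => t _; rewrite mulrA.
Qed.

Lemma scalar_formH (h' : H C) : scalar (fun h => formH h h').
Proof. by move=> a x y; rewrite /formH !mulmxDl -!scalemxAl !mxE. Qed.

(** If x = sum_i c_i u_i, pairing with u'_i gives c_i = <x, u'_i>; linearity of the functional does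
    the rest. *)
Lemma dual_basis_expansion n (u u' : 'I_n -> gel C) L g x :
    scalar L ->
    (forall i j, gform (u i) (u' j) = (i == j)%:R) ->
    (exists c : 'I_n -> C, g_eq x (lincomb c u)) ->
  \sum_i gform x (u' i) * gfun L g (u i) = gfun L g x.
Proof.
move=> linL uu' [c xc]; rewrite (gfun_eq _ _ xc) gfun_lincomb //.
apply: eq_bigr => i _; congr (_ * _).
rewrite gformE (gfun_eq _ _ xc) gfun_lincomb; last exact: scalar_formH.
rewrite (bigD1 i) //= -gformE uu' eqxx mulr1 big1 ?addr0 // => j /negPf ji.
by rewrite -gformE uu' ji mulr0.
Qed.

(** * Mode -1 of e^a on the vacuum and on e^{a'} *)

Lemma formQ0 a : formQ a 0 = 0.
Proof. by rewrite /formQ big1 // => i _; rewrite big1 // => j _; rewrite !mxE mulr0. Qed.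

Lemma eps0 a : eps C a 0 = 1.
Proof.
rewrite /eps big1 // => j _; rewrite big1 // => k _.
by rewrite /lamcoord mul0mx !mxE mulr0 expr0z.
Qed.

Lemma expcoef0 (f : nat -> V C -> V C) v : expcoef f 0 v = v.
Proof. by rewrite /expcoef /= cats0 invr1 scaleV1. Qed.

Lemma Ymode_vac a : Ymode a (-1) (vac C) = ev 1 a.
Proof. by rewrite /Ymode /liftV /= formQ0 /= !fact0 invr1 eps0 !mulr1 addr0. Qed.

(** The factor z^{<a,a'>} is trivial, so mode -1 is the constant term of the exponentials applied to
    e_a e^{a'}. *)
Lemma coef_Ymode_orth a a' m b : formQ a a' = 0 ->
  coefV (Ymode a (-1) (ev 1 a')) m b = eps C a a' * coefV (ev 1 (a + a')) m b.
Proof.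
move=> aa'; rewrite /Ymode /liftV /= aa' /= !fact0 invr1 !mul1r.
by rewrite coefV_cons coefV_nil addr0.
Qed.

(** The z^2 coefficient of exp(A) comes from A and A^2/2. The hypothesis disposes of the empty
    vectors that [powcoef] yields when degrees do not match. *)
Lemma coef_expcoef2 (f : nat -> V C -> V C) v m b :
    (forall k, f k [::] = [::]) ->
  coefV (expcoef f 2 v) m b = coefV (f 2%N v) m b + 2^-1 * coefV (f 1%N (f 1%N v)) m b.
Proof.
by move=> f0; rewrite /expcoef /= !f0 !cats0 !invr1 !scaleV1 coefV_cat coefV_scale.
Qed.

(** The factor z^{-2} turns mode -1 into the z^2 coefficient of the creation exponential, a(-2)/2 +
    a(-1)^2/2; the annihilation exponential fixes e^{a + a'}. *)
Lemma coef_Ymode_opp a a' m b : formQ a a' = - 2%:Z ->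
  coefV (Ymode a (-1) (ev 1 a')) m b = eps C a a' *
   (2^-1 * \sum_j embQ C a 0 j * coefV [:: (1, ([:: (j, 2%N)], a + a'))] m b
  + 2^-1 * \sum_i \sum_j embQ C a 0 i * embQ C a 0 j *
       coefV [:: (1, ([:: (i, 1%N); (j, 1%N)], a + a'))] m b).
Proof.
move=> aa'; rewrite /Ymode /liftV /= aa'.
rewrite [absz _]/= [0 <= _]/= expcoef0 mul1r !cats0.
rewrite coef_expcoef2 /=; last by [].
rewrite -/(ev _ _) heis_scale !coefV_scale !(coef_heisN_ev _ _ _ _ _ _).
rewrite coef_heis_heis invr1 !mul1r mulrDr; congr (_ + _); first by rewrite mulrCA.
by rewrite mulrCA.
Qed.

End Functionals.

(** * The root system of E6 *)

Definition sumz (s : seq int) : int := foldr (fun x y => x + y) 0 s.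
Definition seq6 (f : nat -> int) : seq int := [seq f i | i <- iota 0 6].
Definition all6 (P : pred nat) := all P (iota 0 6).

Lemma all6P P : all6 P -> forall i : 'I_6, P i.
Proof. by move/allP=> P6 i; apply: P6; rewrite mem_iota ltn_ord. Qed.

Lemma sum6 (f : nat -> int) : \sum_(i < 6) f i = sumz (seq6 f).
Proof. by rewrite -(big_mkord xpredT) unlock. Qed.

Definition cartan_nat (i j : nat) : int :=
  if i == j then 2%:Z
  else if ((i, j) \in dynkin_edges) || ((j, i) \in dynkin_edges) then - 1%:Z else 0.

Lemma cartanE i j : cartan i j = cartan_nat i j.
Proof. by rewrite mxE. Qed.

(* Lattice vectors are mirrored by [seq int] so that the checks over the roots
   can be run by [vm_compute]; matrices and big operators do not reduce. *)
Definition vec_of_seq (s : seq int) : Q := \row_i s`_i.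

Definition lamS (s : seq int) := seq6 (fun j => sumz (seq6 (fun i => s`_i * cartan_nat i j))).
Definition formS (s t : seq int) := sumz (seq6 (fun i => (lamS s)`_i * t`_i)).
Definition tauS (s : seq int) := seq6 (fun i => s`_(nth 0 [:: 5; 1; 4; 3; 2; 0] i)%N).
Definition negS (s : seq int) := seq6 (fun i => - s`_i).
Definition addS (s t : seq int) := seq6 (fun i => s`_i + t`_i).

Lemma nth_seq6 f (i : 'I_6) : (seq6 f)`_i = f i.
Proof. by rewrite (nth_map 0%N) ?size_iota // nth_iota. Qed.

Lemma vec_of_negS s : vec_of_seq (negS s) = - vec_of_seq s.
Proof. by apply/rowP => i; rewrite !mxE nth_seq6. Qed.

Lemma vec_of_addS s t : vec_of_seq (addS s t) = vec_of_seq s + vec_of_seq t.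
Proof. by apply/rowP => i; rewrite !mxE nth_seq6. Qed.

Lemma val_tau (i : 'I_6) : tau i = nth 0%N [:: 5; 1; 4; 3; 2; 0]%N i :> nat.
Proof. by rewrite inordK //; exact: (@all6P (fun i => nth 0 _ i < 6)%N). Qed.

Lemma tauK : involutive tau.
Proof.
move=> i; apply: val_inj; rewrite /= !val_tau; apply/eqP; move: i.
exact: (@all6P (fun i => nth 0 _ (nth 0 _ i) == i)%N).
Qed.

Lemma vec_of_tauS s : vec_of_seq (tauS s) = tauQ (vec_of_seq s).
Proof. by apply/rowP => i; rewrite !mxE nth_seq6 val_tau. Qed.

Lemma tauQK : involutive tauQ.
Proof. by move=> a; apply/rowP => i; rewrite !mxE tauK. Qed.

Lemma tauQN a : tauQ (- a) = - tauQ a.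
Proof. by apply/rowP => i; rewrite !mxE. Qed.

Lemma lamcoord_vec s (j : 'I_6) : lamcoord (vec_of_seq s) 0 j = (lamS s)`_j.
Proof.
rewrite /lamcoord !mxE nth_seq6 -sum6; apply: eq_bigr => i _.
by rewrite cartanE mxE.
Qed.

Lemma formQ_vec s t : formQ (vec_of_seq s) (vec_of_seq t) = formS s t.
Proof.
rewrite /formQ exchange_big /formS -sum6 /=; apply: eq_bigr => j _.
rewrite -mulr_suml mxE; congr (_ * _); rewrite -lamcoord_vec /lamcoord mxE.
by apply: eq_bigr => i _; rewrite mxE.
Qed.

(** Parity of the exponent of -1 in eps(s, t); only the matrix entries equal to -1 contribute. *)
Definition epsS (s t : seq int) : bool :=
  odd (absz (sumz (seq6 (fun j => sumz (seq6 (fun k =>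
    if nth 1 (nth [::] eps_rows j) k == -1 then (lamS s)`_j * (lamS t)`_k else 0)))))).

Lemma eps_vec (C : numClosedFieldType) s t : eps C (vec_of_seq s) (vec_of_seq t) = (-1) ^+ epsS s t.
Proof.
rewrite /epsS; set N := sumz _.
have -> : (-1) ^+ odd `|N|%N = (-1) ^ N :> C.
  rewrite signr_odd; case: N => n //.
  by rewrite -[RHS]/(((-1) ^+ n.+1)^-1) invr_sign.
have expM : {morph (fun z : int => (-1) ^ z : C) : x y / x + y >-> x * y}.
  by move=> x y; rewrite expfzDr // oppr_eq0 oner_eq0.
rewrite /N -sum6 (big_morph _ expM (expr0z _)) /eps; apply: eq_bigr => j _.
rewrite -sum6 (big_morph _ expM (expr0z _)).
apply: eq_bigr => k _; rewrite !lamcoord_vec mxE.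
have : all6 (fun j => all6 (fun k =>
   nth 1 (nth [::] eps_rows j) k \in [:: 1; -1])) by vm_compute.
move/all6P => /(_ j) /all6P /(_ k); rewrite !inE => /orP[] /eqP -> /=.
  by rewrite exp1rz expr0z.
by rewrite rmorphN1.
Qed.

(** * Enumeration of the roots *)

Definition range (k : nat) : seq int := [seq i%:Z - k%:Z | i <- iota 0 k.*2.+1].
(** The bounds 1, 2, 2, 3, 2, 1 are the coefficients of the highest root. *)
Definition box : seq (seq int) :=
  foldr (fun k L => [seq x :: s | x <- range k, s <- L]) [:: [::]] [:: 1; 2; 2; 3; 2; 1]%N.
Definition PhiS := [seq s <- box | formS s s == 2].
Definition Phi := map vec_of_seq PhiS.

Lemma mem_range (x : int) k : `|x| <= k%:Z -> x \in range k.
Proof.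
move=> xk; apply/mapP; exists (absz (x + k%:Z)); last by lia.
by rewrite mem_iota; lia.
Qed.

Lemma E6_bounds (x0 x1 x2 x3 x4 x5 : int) :
   formS [:: x0; x1; x2; x3; x4; x5] [:: x0; x1; x2; x3; x4; x5] = 2 ->
   [/\ `|x0| <= 1, `|x1| <= 2, `|x2| <= 2 & [/\ `|x3| <= 3, `|x4| <= 2 & `|x5| <= 1]].
Proof.
move=> e.
have {}e : x0 * x0 + x1 * x1 + x2 * x2 + x3 * x3 + x4 * x4 + x5 * x5
   - x0 * x2 - x2 * x3 - x3 * x4 - x4 * x5 - x1 * x3 = 1.
  by move: e; rewrite /formS /lamS /sumz /seq6 /= /cartan_nat !inE /= ?mulr0 ?add0r ?addr0; lia.
(* Completing squares along the tree rooted at node i bounds x_i^2 by twice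
   the i-th diagonal entry of the inverse Cartan matrix. *)
have sq (x y : int) : 0 <= (x - y) * (x - y) by rewrite -expr2 sqr_ge0.
have s02 := sq (2%:Z * x0) x2; have s23 := sq (3%:Z * x2) (2%:Z * x3).
have s54 := sq (2%:Z * x5) x4; have s43 := sq (3%:Z * x4) (2%:Z * x3).
have s13 := sq (2%:Z * x1) x3.
have s32 := sq (5%:Z * x3) (6%:Z * x2); have s34 := sq (5%:Z * x3) (6%:Z * x4).
have s20 := sq (4%:Z * x2) (5%:Z * x0); have s45 := sq (4%:Z * x4) (5%:Z * x5).
have s31 := sq (2%:Z * x3) (3%:Z * x1).
have b0 : 3%:Z * (x0 * x0) <= 8%:Z by lia.
have b1 : x1 * x1 <= 4%:Z by lia.
have b2 : 3%:Z * (x2 * x2) <= 20%:Z by lia.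
have b3 : x3 * x3 <= 12%:Z by lia.
have b4 : 3%:Z * (x4 * x4) <= 20%:Z by lia.
have b5 : 3%:Z * (x5 * x5) <= 8%:Z by lia.
clear e sq s02 s23 s54 s43 s13 s32 s34 s20 s45 s31.
(* Integrality rounds the bounds 8/3, 4, 20/3, 12 on the squares to 1, 2, 2, 3 on the absolute
   values. *)
by do !split; nia.
Qed.

Definition seq_of_vec (a : Q) := seq6 (fun i => a 0 (inord i)).

Lemma seq_of_vecK a : vec_of_seq (seq_of_vec a) = a.
Proof. by apply/rowP => i; rewrite mxE nth_seq6 inord_val. Qed.

Lemma vec_of_seqK s : size s = 6%N -> seq_of_vec (vec_of_seq s) = s.
Proof.
move=> s6; apply: (@eq_from_nth _ 0); rewrite ?size_map ?size_iota // => i i6.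
by rewrite (nth_seq6 _ (Ordinal i6)) /= mxE inordK.
Qed.

(** Completeness of the enumeration: the root part of an element of a can be summed over the fixed
    list [Phi]. *)
Lemma mem_Phi a : formQ a a = 2 -> a \in Phi.
Proof.
rewrite -(seq_of_vecK a) formQ_vec => a2; apply/mapP; exists (seq_of_vec a) => //.
rewrite mem_filter a2 eqxx /=; have [b0 b1 b2 [b3 b4 b5]] := E6_bounds a2.
by do 6?[apply: (allpairs_f cons); first exact: mem_range].
Qed.

(** The second and third items put the projected dual vectors in a, the next two give the powers of
    z, and the last makes the normalisation of x_{-alpha} also right for x_{-tau alpha}. *)
Lemma PhiS_check : all (fun s => [&& size s == 6%N,
    formS (negS s) (negS s) == 2, formS (negS (tauS s)) (negS (tauS s)) == 2,
    formS (negS s) s == - 2%:Z,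
    (tauS s == s) || (formS (negS (tauS s)) s == 0)
  & epsS (negS (tauS s)) (tauS s) == epsS (negS s) s]) PhiS.
Proof. by vm_compute. Qed.

Lemma Phi_uniq : uniq Phi.
Proof.
rewrite map_inj_in_uniq; first by vm_compute.
move=> s t /(allP PhiS_check) /andP[/eqP s6 _] /(allP PhiS_check) /andP[/eqP t6 _] st.
by rewrite -(vec_of_seqK s6) st vec_of_seqK.
Qed.

(** Three times the inverse Cartan matrix, which is integral because the determinant is 3. *)
Definition tri_inv_cartan : seq (seq int) :=
  [:: [:: 4; 3; 5; 6; 4; 2]; [:: 3; 6; 6; 9; 6; 3]; [:: 5; 6; 10; 12; 8; 4];
      [:: 6; 9; 12; 18; 12; 6]; [:: 4; 6; 8; 12; 10; 5]; [:: 2; 3; 4; 6; 5; 4]].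
(* [lambda_i = sum_j (lam3 i j)/3 alpha_j]. *)
Definition lam3 (i j : nat) : int := nth 0 (nth [::] tri_inv_cartan i) j.

(* A tau-fixed root contributes its quadratic part twice, once as alpha and
   once as tau alpha. *)
Definition weightS (s : seq int) : int := if tauS s == s then 2%:Z else 1.
Definition quadS (i j : nat) : int := sumz [seq weightS s * (s`_i * s`_j) | s <- PhiS].

(** The alpha(-2) terms cancel between alpha and -alpha, which have equal weight. *)
Lemma linear_check : all6 (fun j => sumz [seq weightS s * s`_j | s <- PhiS] == 0).
Proof. by vm_compute. Qed.

Definition tau_nat i := nth 0%N [:: 5; 1; 4; 3; 2; 0]%N i.
(* Three times the coordinates of the three squared weights of [omega_rhs]. *)
Definition sq1_coord3 j : int := lam3 5 j - lam3 0 j.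
Definition sq2_coord3 j : int := lam3 2 j - lam3 4 j.
Definition sq3_coord3 j : int := lam3 0 j - lam3 2 j + lam3 4 j - lam3 5 j.

(** Comparison of the coefficients of alpha_i(-1) alpha_j(-1) on both sides of the theorem,
    multiplied by 720 to clear denominators. *)
Lemma quad_check : all6 (fun i => all6 (fun j =>
  120%:Z * lam3 i j - 6%:Z * (lam3 j i + lam3 (tau_nat j) i) - 9%:Z * quadS i j
  == 8%:Z * (sq1_coord3 i * sq1_coord3 j + sq2_coord3 i * sq2_coord3 j
             + sq3_coord3 i * sq3_coord3 j))).
Proof. by vm_compute. Qed.

(** The product eps(-alpha, alpha) eps(-tau alpha, alpha): the first factor normalises the dual
    vector, the second comes from the mode. *)
Definition signS (s : seq int) : int :=
  if epsS (negS s) s == epsS (negS (tauS s)) s then 1 else - 1%:Z.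

(* The signed vectors alpha - tau alpha, alpha running over the moved roots. *)
Definition orth_terms : seq (int * seq int) :=
  [seq (signS s, addS (negS (tauS s)) s) | s <- PhiS & tauS s != s].
(** The exponents of [omega_rhs] with opposite signs, since the F4 vector is subtracted there. *)
Definition norm4_terms : seq (int * seq int) :=
  [:: (1, [:: 1; 0; 0; 0; 0; -1]); (1, [:: 0; 0; 1; 0; -1; 0]);
      (-1, [:: 1; 0; 1; 0; -1; -1]); (1, [:: -1; 0; 0; 0; 0; 1]);
      (1, [:: 0; 0; -1; 0; 1; 0]); (-1, [:: -1; 0; -1; 0; 1; 1])].

(** Each of the six vectors arises from 8 of the 48 moved roots, always with the same sign. *)
Lemma orth_terms_check : all (fun t => t.2 \in map snd norm4_terms) orth_terms &&
  all (fun t => sumz [seq x.1 | x <- orth_terms & x.2 == t.2] == 8%:Z * t.1) norm4_terms.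
Proof. by vm_compute. Qed.

(** * Projected dual basis of g *)

Section Dual.
Variable C : numClosedFieldType.

Lemma cartanC_rinv :
  cartanC C *m (\matrix_(i, j) ((lam3 i j)%:~R / 3%:R)) = 1%:M.
Proof.
apply/matrixP => k l; rewrite !mxE.
under eq_bigr => m _ do rewrite !mxE mulrA -rmorphM.
rewrite -mulr_suml -rmorph_sum /=.
under eq_bigr => m _ do rewrite -/(cartan_nat k m).
rewrite (sum6 (fun m => cartan_nat k m * lam3 m l)).
have : all6 (fun k => all6 (fun l =>
  sumz (seq6 (fun m => cartan_nat k m * lam3 m l)) == (if k == l then 3%:Z else 0))).
  by vm_compute.
move/all6P => /(_ k) /all6P /(_ l) /eqP ->; rewrite -val_eqE /=.
by case: ifP => _; rewrite ?mul0r // divff // pnatr_eq0.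
Qed.

Lemma cartanC_unit : cartanC C \in unitmx.
Proof. by case: (mulmx1_unit cartanC_rinv). Qed.

Lemma lamHE i j : (lamH C i) 0 j = (lam3 i j)%:~R / 3%:R.
Proof.
rewrite /lamH mxE -[invmx _]mulmx1 -cartanC_rinv mulKmx ?mxE //.
exact: cartanC_unit.
Qed.

Lemma formH_lamH i (h : H C) : formH (lamH C i) h = h 0 i.
Proof. by rewrite /formH /lamH -row_mul mulVmx ?cartanC_unit // -row_mul mul1mx !mxE. Qed.

Definition dualH j : gel C := (2%:R^-1 *: (lamH C j + lamH C (tau j)), [::]).

(** For a tau-fixed root the two entries name the same root and add up, so the factor 1/2 suits both
    cases. *)
Definition dualX (a : Q) : gel C :=
  let c := 2%:R^-1 * eps C (- a) a in (0, [:: (c, - a); (c, - tauQ a)]).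

Lemma inA_dualH j : inA (dualH j).
Proof.
split=> [a|i|a] /=; rewrite /coefR ?big_nil ?eqxx // !mxE -!/(lamH _ _ _ _).
(* The inverse Cartan matrix is invariant under the diagram automorphism. *)
have lam_tau k l : (lamH C k) 0 (tau l) = (lamH C (tau k)) 0 l.
  have : all6 (fun k => all6 (fun l => lam3 k (tau_nat l) == lam3 (tau_nat k) l)).
    by vm_compute.
  by move=> /all6P /(_ k) /all6P /(_ l) /eqP e; rewrite !lamHE !val_tau -/(tau_nat _) e.
have:= lam_tau j i; have:= lam_tau (tau j) i; rewrite tauK !mxE => -> ->.
by rewrite addrC.
Qed.

(** The weights lambda_j and tau lambda_j read off coordinates j and tau j of [y], which agree
    because [y] is tau-fixed. *)
Lemma gform_dualH j y : inA y -> gform (dualH j) y = y.1 0 j.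
Proof.
case=> _ ytau _; rewrite /gform /= big_nil addr0.
rewrite -[X in formH X _]addr0 scalar_formH.
have L0 : formH (0 : H C) y.1 = 0 by rewrite /formH !mul0mx mxE.
rewrite L0 addr0 -[lamH C j]scale1r scalar_formH !formH_lamH ytau mul1r.
by field.
Qed.

Lemma inA_dualX s : s \in PhiS -> inA (dualX (vec_of_seq s)).
Proof.
move/(allP PhiS_check)=> /and5P[_ /eqP n1 /eqP n2 _ _].
split=> [a|i|a] /=; last 2 first.
- by rewrite !mxE.
- have injtau := inv_inj tauQK.
  have e1 : (- tauQ (vec_of_seq s) == tauQ a) = (- vec_of_seq s == a).
    by rewrite -tauQN (inj_eq injtau).
  have e2 : (- tauQ (vec_of_seq s) == a) = (- vec_of_seq s == tauQ a).
    by rewrite -(inj_eq injtau) tauQN tauQK.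
  rewrite /coefR !big_cons !big_nil /= e1 e2.
  by do 2!case: ifP => _; rewrite ?addr0.
move/coefR_mem; rewrite !inE => /orP[] /eqP -> /=.
  by rewrite -vec_of_negS formQ_vec.
by rewrite -vec_of_tauS -vec_of_negS formQ_vec.
Qed.

Lemma eps_sqr s t : eps C (vec_of_seq s) (vec_of_seq t) * eps C (vec_of_seq s) (vec_of_seq t) = 1.
Proof. by rewrite eps_vec -signr_addb addbb. Qed.

(** The two terms read off the coefficients of [y] at alpha and tau alpha, which agree; the sign in
    [dualX] meets the equal sign of the form and squares to 1. *)
Lemma gform_dualX s y : s \in PhiS -> inA y ->
  gform (dualX (vec_of_seq s)) y = coefR y.2 (vec_of_seq s).
Proof.
move/(allP PhiS_check)=> /andP[_ /and5P[_ _ _ _ /eqP e]] [_ _ ytau].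
have pair c (a : Q) : \sum_(t <- y.2) c * t.1 * (if - a + t.2 == 0 then eps C (- a) (- - a) else 0)
    = c * eps C (- a) a * coefR y.2 a.
  rewrite /coefR mulr_sumr [RHS]big_mkcond /=; apply: eq_bigr => t _.
  rewrite addrC subr_eq0 opprK; case: ifP => _; last by rewrite mulr0.
  by rewrite mulrAC.
rewrite /gform /= /formH !mul0mx mxE add0r !big_cons big_nil addr0 /= !pair.
have -> : eps C (- tauQ (vec_of_seq s)) (tauQ (vec_of_seq s)) =
          eps C (- vec_of_seq s) (vec_of_seq s).
  by rewrite -vec_of_tauS -!vec_of_negS !eps_vec e.
rewrite ytau -!(mulrA 2%:R^-1) -vec_of_negS eps_sqr.
by field.
Qed.

End Dual.

(** * The Sugawara vector of F4 *)

Section F4Casimir.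
Variable C : numClosedFieldType.
Implicit Types (x y : gel C) (m : mono) (b : Q).

Lemma coef_gact_vac x y m b : inA y ->
  coefV (gact x (-1) (gact y (-1) (vac C))) m b =
  \sum_j y.1 0 j * coefV (gact x (-1) [:: (1, ([:: (j, 1%N)], 0))]) m b
  + \sum_(k <- Phi) coefR y.2 k * coefV (gact x (-1) (ev 1 k)) m b.
Proof.
case=> yPhi _ _; rewrite {2}/gact coef_gact_cat; congr (_ + _).
  rewrite coef_gact_expand /heis /liftV /= cats0 big_map big_enum /=.
  by apply: eq_bigr => j _; rewrite mul1r.
rewrite -(sum_coefR (fun k => coefV (gact x (-1) (ev 1 k)) m b) Phi_uniq); last first.
  by move=> a /yPhi /mem_Phi.
rewrite coef_gact_expand big_flatten big_map; apply: eq_bigr => t _.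
by rewrite Ymode_vac big_seq1 /= mulr1.
Qed.

Lemma casimir_sum n (u u' : 'I_n -> gel C) m b :
  (forall i, inA (u' i)) ->
  (forall i j, gform (u i) (u' j) = (i == j)%:R) ->
  (forall x : gel C, inA x -> exists c : 'I_n -> C, g_eq x (lincomb c u)) ->
  \sum_i coefV (gact (u i) (-1) (gact (u' i) (-1) (vac C))) m b =
  \sum_j coefV (gact (dualH C j) (-1) [:: (1, ([:: (j, 1%N)], 0))]) m b
  + \sum_(s <- PhiS) coefV (gact (dualX C (vec_of_seq s)) (-1) (ev 1 (vec_of_seq s))) m b.
Proof.
move=> u'A uu' spanA.
under eq_bigr => i _ do rewrite coef_gact_vac //.
rewrite big_split /=; congr (_ + _); rewrite exchange_big /=.
  apply: eq_bigr => j _; rewrite coef_gactE.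
  (* Coordinate j of u'_i is its pairing with [dualH C j], so the sum over i is the expansion of
     [dualH C j] in the basis [u]. *)
  rewrite -(dual_basis_expansion _ (scalar_coef_heis _ _ _) uu' (spanA _ (inA_dualH C j))).
  by apply: eq_bigr => i _; rewrite gform_dualH // coef_gactE.
rewrite big_map; apply: eq_big_seq => s sPhi; rewrite coef_gactE.
rewrite -(dual_basis_expansion _ (scalar_coef_heis _ _ _) uu' (spanA _ (inA_dualX C sPhi))).
by apply: eq_bigr => i _; rewrite gform_dualX // coef_gactE.
Qed.

(** * Reduction to identities between scalar coefficients *)

Section Coefficients.
Variables (m : mono) (b : Q).
Definition quad i j : C := coefV [:: (1, ([:: (i, 1%N); (j, 1%N)], 0))] m b.
Definition lin j : C := coefV [:: (1, ([:: (j, 2%N)], 0))] m b.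
Definition grp a : C := coefV (ev 1 a) m b.

Lemma coef_dualH j :
  coefV (gact (dualH C j) (-1) [:: (1, ([:: (j, 1%N)], 0))]) m b =
  \sum_(i < 6) (lam3 j i + lam3 (tau_nat j) i)%:~R / 6%:R * quad i j.
Proof.
rewrite coef_gact big_nil addr0 (coef_heisN _ 0) big_seq1 /=.
apply: eq_bigr => i _; rewrite mul1r 2!mxE; congr (_ * _).
by rewrite !lamHE rmorphD val_tau -/(tau_nat _); field.
Qed.

(** The x_{-alpha} half gives the linear and quadratic terms, with 1/4 = 1/2 * 1/2. The other half
    repeats it for a fixed root, hence [weightS], and gives e^{alpha - tau alpha} for a moved
    one. *)
Lemma coef_dualX s : s \in PhiS ->
  coefV (gact (dualX C (vec_of_seq s)) (-1) (ev 1 (vec_of_seq s))) m b =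
  - (4%:R^-1 * \sum_(j < 6) (weightS s * s`_j)%:~R * lin j)
  + 4%:R^-1 * (\sum_(i < 6) \sum_(j < 6) (weightS s * (s`_i * s`_j))%:~R * quad i j)
  + (if tauS s != s then
       2%:R^-1 * ((signS s)%:~R * grp (vec_of_seq (addS (negS (tauS s)) s))) else 0).
Proof.
move/(allP PhiS_check)=> /andP[_ /and5P[_ _ /eqP s2 s0 _]].
have h0 : coefV (heis (0 : H C) (-1) (ev 1 (vec_of_seq s))) m b = 0.
  rewrite (coef_heisN _ 0) big_seq1 big1 // => j _.
  by rewrite mxE mulr0 mul0r.
have opp : 2%:R^-1 * eps C (- vec_of_seq s) (vec_of_seq s)
     * coefV (Ymode (- vec_of_seq s) (-1) (ev 1 (vec_of_seq s))) m b =
  - (4%:R^-1 * \sum_(j < 6) (s`_j)%:~R * lin j)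
  + 4%:R^-1 * (\sum_(i < 6) \sum_(j < 6) (s`_i * s`_j)%:~R * quad i j).
  rewrite coef_Ymode_opp; last by rewrite -vec_of_negS formQ_vec s2.
  have e2 : eps C (- vec_of_seq s) (vec_of_seq s) * eps C (- vec_of_seq s) (vec_of_seq s) = 1.
    by rewrite -vec_of_negS eps_sqr.
  (* The sign in [dualX] cancels the one produced by the mode. *)
  rewrite addNr -(mulrA 2%:R^-1) (mulrA (eps _ _ _)) e2 mul1r.
  rewrite mulrDr !mulrA -!invfM -natrM -mulrN -sumrN.
  congr (_ * _ + _ * _); apply: eq_bigr => i _.
    by rewrite !mxE mulrNz mulNr.
  by apply: eq_bigr => j _; rewrite !mxE !mulrNz mulrNN rmorphM.
rewrite coef_gact h0 add0r !big_cons big_nil addr0 /= opp.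
case: (eqVneq (tauS s) s) s0 => [ts _ | ts /= /eqP s0].
  rewrite -vec_of_tauS ts opp addr0 /weightS ts eqxx.
  under [in RHS]eq_bigr => j _ do rewrite rmorphM -mulrA.
  rewrite -mulr_sumr.
  under [X in _ = _ + _ * X]eq_bigr => i _.
    under eq_bigr => j _ do rewrite rmorphM -mulrA.
    rewrite -mulr_sumr; over.
  rewrite -mulr_sumr /=; ring.
rewrite /weightS (negPf ts).
under [in RHS]eq_bigr => j _ do rewrite mul1r.
under [X in _ = _ + _ * X + _]eq_bigr => i _ do under eq_bigr => j _ do rewrite mul1r.
congr (_ + _); rewrite -vec_of_tauS -!vec_of_negS coef_Ymode_orth ?formQ_vec //.
rewrite -vec_of_addS -/(grp _) !mulrA; congr (_ * _); rewrite -mulrA; congr (_ * _).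
rewrite !eps_vec -signr_addb /signS; case: eqP => [->|]; first by rewrite addbb.
by case: (epsS _ _); case: (epsS _ _).
Qed.

Lemma coef_ev c a : coefV (ev c a) m b = c * grp a.
Proof. by rewrite /ev coefV_cons coefV_nil addr0. Qed.

Lemma coef_sqv h : coefV (sqv h) m b = \sum_i \sum_j h 0 i * h 0 j * quad i j.
Proof. by rewrite /sqv coef_heis_heis mul1r. Qed.

Lemma coef_omegaE6 :
  coefV (omegaE6 C) m b = 2%:R^-1 * \sum_(i < 6) \sum_(j < 6) (lam3 i j)%:~R / 3%:R * quad i j.
Proof.
rewrite /omegaE6 coefV_scale coefV_flatten_enum mul1r; congr (_ * _).
apply: eq_bigr => i _; rewrite coef_heis_heis mul1r (bigD1 i) //= [X in _ + X]big1 ?addr0.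
  by apply: eq_bigr => j _; rewrite mxE !eqxx mul1r lamHE.
by move=> k /negPf ki; rewrite big1 // => j _; rewrite mxE ki mul0r mul0r.
Qed.

Lemma sumz_map (I : Type) (r : seq I) f : sumz (map f r) = \sum_(i <- r) f i.
Proof. by elim: r => [|i r IHr]; rewrite ?big_nil // big_cons /= IHr. Qed.

Lemma sum_lin : \sum_(s <- PhiS) \sum_(j < 6) (weightS s * s`_j)%:~R * lin j = 0.
Proof.
rewrite exchange_big big1 // => j _; rewrite -mulr_suml -rmorph_sum /=.
by have /all6P /(_ j) /eqP := linear_check; rewrite sumz_map => ->; rewrite mul0r.
Qed.

Lemma sum_quad :
  \sum_(s <- PhiS) \sum_(i < 6) \sum_(j < 6) (weightS s * (s`_i * s`_j))%:~R * quad i j =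
  \sum_(i < 6) \sum_(j < 6) (quadS i j)%:~R * quad i j.
Proof.
rewrite exchange_big; apply: eq_bigr => i _; rewrite exchange_big; apply: eq_bigr => j _.
by rewrite /= /quadS sumz_map rmorph_sum mulr_suml.
Qed.

(** Grouping by lattice vector turns the multiplicity 8 and the factor 1/2 into 4. *)
Lemma sum_grp :
  \sum_(s <- PhiS) (if tauS s != s then
       2%:R^-1 * ((signS s)%:~R * grp (vec_of_seq (addS (negS (tauS s)) s))) else 0) =
  4%:R * \sum_(t <- norm4_terms) t.1%:~R * grp (vec_of_seq t.2).
Proof.
rewrite -big_mkcond -big_filter -mulr_sumr.
have -> : \sum_(s <- [seq s <- PhiS | tauS s != s])
     (signS s)%:~R * grp (vec_of_seq (addS (negS (tauS s)) s)) =
   \sum_(t <- orth_terms) t.1%:~R * grp (vec_of_seq t.2) by rewrite /orth_terms big_map.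
have /andP[/allP termsP /allP norm4P] := orth_terms_check.
rewrite (sum_fiber (fun t : int * seq int => (t.1)%:~R) (fun a => grp (vec_of_seq a)) _ termsP) //.
rewrite big_map !mulr_sumr; apply: eq_big_seq => t /norm4P /eqP.
rewrite sumz_map big_filter -rmorph_sum /= => ->.
by rewrite rmorphM /= -mulrA !mulrA; congr (_ * _ * _); field.
Qed.

Lemma sq1_coordE i : (- lamH C 0 + lamH C 5) 0 i = (sq1_coord3 i)%:~R / 3%:R.
Proof.
rewrite [(_ + _ : 'rV_6) 0 i]mxE [(- _ : 'rV_6) 0 i]mxE !lamHE.
by rewrite -mulNr -mulrDl addrC -rmorphB.
Qed.

Lemma sq2_coordE i : (lamH C 2 - lamH C 4) 0 i = (sq2_coord3 i)%:~R / 3%:R.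
Proof.
rewrite [(_ + _ : 'rV_6) 0 i]mxE [(- _ : 'rV_6) 0 i]mxE !lamHE.
by rewrite -mulrBl -rmorphB.
Qed.

Lemma sq3_coordE i : (lamH C 0 - lamH C 2 + lamH C 4 - lamH C 5) 0 i = (sq3_coord3 i)%:~R / 3%:R.
Proof.
rewrite 3![(_ + _ : 'rV_6) 0 i]mxE 2![(- _ : 'rV_6) 0 i]mxE !lamHE.
by rewrite -mulrBl -mulrDl -mulrBl -rmorphB -rmorphD -rmorphB.
Qed.

Lemma quad_coef_identity (x y z w h1 k1 h2 k2 h3 k3 : int) :
    120%:Z * x - 6%:Z * (y + z) - 9%:Z * w = 8%:Z * (h1 * k1 + h2 * k2 + h3 * k3) ->
  2%:R^-1 * (x%:~R / 3%:R) - 20%:R^-1 * ((y + z)%:~R / 6%:R) - 80%:R^-1 * w%:~R =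
  10%:R^-1 * ((h1%:~R / 3%:R) * (k1%:~R / 3%:R) + (h2%:~R / 3%:R) * (k2%:~R / 3%:R)
     + (h3%:~R / 3%:R) * (k3%:~R / 3%:R)) :> C.
Proof.
move/(congr1 (fun t : int => t%:~R : C)); rewrite !(rmorphB, rmorphD, rmorphM) /= => H.
(* 720 is the least common multiple of the denominators 6, 120, 80 and 90. *)
apply: (@mulfI _ 720%:R); first by rewrite pnatr_eq0.
transitivity (120%:R * x%:~R - 6%:R * (y%:~R + z%:~R) - 9%:R * w%:~R : C); first by field.
by rewrite H; field.
Qed.

(** The factor 1/80 is the Sugawara 1/20 times the 1/4 of the root terms. *)
Lemma quad_identity :
  2%:R^-1 * (\sum_(i < 6) \sum_(j < 6) (lam3 i j)%:~R / 3%:R * quad i j)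
  - 20%:R^-1 * (\sum_(j < 6) \sum_(i < 6)
                 (lam3 j i + lam3 (tau_nat j) i)%:~R / 6%:R * quad i j)
  - 80%:R^-1 * (\sum_(i < 6) \sum_(j < 6) (quadS i j)%:~R * quad i j) =
  10%:R^-1 * (coefV (sqv (- lamH C 0 + lamH C 5)) m b
     + coefV (sqv (lamH C 2 - lamH C 4)) m b
     + coefV (sqv (lamH C 0 - lamH C 2 + lamH C 4 - lamH C 5)) m b).
Proof.
(* Swapping the middle double sum aligns its monomials with the others, so the identity can be
   checked entry by entry. *)
rewrite !coef_sqv [X in _ - _ * X - _]exchange_big -!big_split /= !mulr_sumr -!sumrB.
apply: eq_bigr => i _; rewrite -!big_split /= !mulr_sumr -!sumrB.
apply: eq_bigr => j _.
rewrite sq1_coordE sq1_coordE sq2_coordE sq2_coordE sq3_coordE sq3_coordE.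
rewrite -!mulrDl !(mulrA _ _ (quad i j)) -!mulrBl; congr (_ * _).
apply: quad_coef_identity; apply/eqP.
by have /all6P /(_ i) /all6P /(_ j) := quad_check.
Qed.

End Coefficients.

Lemma aQ_ofs :
  [/\ aQ 0 - aQ 5 = vec_of_seq [:: 1; 0; 0; 0; 0; -1],
      aQ 2 - aQ 4 = vec_of_seq [:: 0; 0; 1; 0; -1; 0],
      aQ 0 + aQ 2 - aQ 4 - aQ 5 = vec_of_seq [:: 1; 0; 1; 0; -1; -1]
    & [/\ - aQ 0 + aQ 5 = vec_of_seq [:: -1; 0; 0; 0; 0; 1],
          - aQ 2 + aQ 4 = vec_of_seq [:: 0; 0; -1; 0; 1; 0]
        & - aQ 0 - aQ 2 + aQ 4 + aQ 5 = vec_of_seq [:: -1; 0; -1; 0; 1; 1]]].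
Proof.
by do !split; apply/rowP => -[[|[|[|[|[|[|//]]]]]] ?]; rewrite !mxE; vm_compute.
Qed.
End F4Casimir.

Theorem theorem5p2 (C : numClosedFieldType) (n : nat) (u u' : 'I_n -> gel C) :
  (forall i, inA (u i)) ->
  (forall i, inA (u' i)) ->
  (forall i j, gform (u i) (u' j) = (i == j)%:R) ->
  (forall x : gel C, inA x -> exists c : 'I_n -> C, g_eq x (lincomb c u)) ->
  veq (omega u u') (omega_rhs C).
Proof.
move=> _ u'A uu' spanA m b.
have [d1 d2 d3 [d4 d5 d6]] := aQ_ofs.
have := casimir_sum m b u'A uu' spanA.
under [in RHS]eq_bigr => j _ do rewrite coef_dualH.
under [X in _ = _ + X]eq_big_seq => s sPhi do rewrite coef_dualX //.
rewrite 2!big_split /= sumrN -2!mulr_sumr sum_lin sum_quad sum_grp => casE.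
rewrite /omega coefV_cat coef_omegaE6 !coefV_scale coefV_flatten_enum casE.
rewrite /omega_rhs !coefV_cat !coefV_scale !coefV_cat !coef_ev d1 d2 d3 d4 d5 d6.
rewrite [1 / 10%:R]mul1r [X in _ = _ * X + _]addrA -quad_identity.
(* Only the exponential terms remain; their coefficient is 4/20 = 1/5. *)
rewrite /norm4_terms !big_cons big_nil /= !rmorphN1 !rmorph1.
by field.
Qed.
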